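(* Let $G$ be a countable locally finite group. Then the set of actions of $G$ on $C(2^{\mathbb{N}})$ by linear isometries that admit an equivalent $G$-invariant strictly convex norm is comeager in $\mathrm{Act}_G(C(2^{\mathbb{N}}))$.
   Context: $2^{\mathbb{N}}$ is the Cantor space and $C(2^{\mathbb{N}})$ the real Banach space of continuous functions on it with the sup norm. $\mathrm{Iso}(C(2^{\mathbb{N}}))$ is the group of surjective linear isometries with the strong operator topology, and $\mathrm{Act}_G(C(2^{\mathbb{N}}))$ is the set of homomorphisms $G\to\mathrm{Iso}(C(2^{\mathbb{N}}))$, viewed as a closed subset of $\mathrm{Iso}(C(2^{\mathbb{N}}))^G$ with the product topology (a Polish space). A group is locally finite if every finitely generated subgroup is finite. A norm is $G$-invariant if each $g$ acts isometrically for it; strictly convex if for $f\neq h$ of equal norm, $\|\frac{f+h}{2}\|<\|f\|$. *)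

(* Defs.v *)
From HB Require Import structures.
From mathcomp Require Import all_boot all_order all_algebra.
From mathcomp Require Import all_classical all_reals all_analysis.
Set Implicit Arguments. Unset Strict Implicit. Unset Printing Implicit Defensive.
Import Order.TTheory GRing.Theory Num.Theory.
Import numFieldTopology.Exports.
Local Open Scope classical_set_scope.
Local Open Scope ring_scope.

Definition gen_subgroup (G : groupType) (S : set G) : set G :=
  \bigcap_(H in [set H : set G | [/\ S `<=` H, H 1%g,
            (forall x y, H x -> H y -> H (x * y)%g) &
            (forall x, H x -> H (x^-1)%g)]]) H.

Definition locally_finite (G : groupType) : Prop :=
  forall S : set G, finite_set S -> finite_set (gen_subgroup S).

Definition CK (R : realType) := {f : cantor_space -> R | continuous f}.

Definition supnorm (R : realType) (f : cantor_space -> R) : R :=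
  sup [set `|f x| | x in [set: cantor_space]].

Definition is_lin_iso (R : realType) (T : CK R -> CK R) : Prop :=
  [/\ (forall (a : R) (f g h : CK R),
         (forall x, sval h x = a * sval f x + sval g x) ->
         forall x, sval (T h) x = a * sval (T f) x + sval (T g) x),
      (forall f, supnorm (sval (T f)) = supnorm (sval f)) &
      (forall g, exists f, T f = g)].

Definition is_action (G : groupType) (R : realType) (rho : G -> CK R -> CK R) : Prop :=
  (forall g, is_lin_iso (rho g)) /\
  (forall g h f, rho (g * h)%g f = rho g (rho h f)).

Definition Act (G : groupType) (R : realType) : set (G -> CK R -> CK R) :=
  [set rho | is_action rho].

(* ---------- topology of Act_G (product of strong operator topologies) ---------- *)
Definition act_ball (G : groupType) (R : realType) (rho : G -> CK R -> CK R)
  (n : nat) (gf : nat -> G * CK R) (e : R) : set (G -> CK R -> CK R) :=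
  [set sigma | forall i, (i < n)%N ->
     supnorm (fun x => sval (sigma (gf i).1 (gf i).2) x - sval (rho (gf i).1 (gf i).2) x) < e].

Definition act_open (G : groupType) (R : realType) (U : set (G -> CK R -> CK R)) : Prop :=
  U `<=` @Act G R /\
  forall rho, U rho -> exists n gf (e : R), 0 < e /\ @Act G R `&` act_ball rho n gf e `<=` U.

Definition act_closure (G : groupType) (R : realType) (N : set (G -> CK R -> CK R))
  : set (G -> CK R -> CK R) :=
  [set rho | @Act G R rho /\ forall n gf (e : R), 0 < e ->
     exists sigma, [/\ @Act G R sigma, N sigma & act_ball rho n gf e sigma]].

Definition act_nowhere_dense (G : groupType) (R : realType) (N : set (G -> CK R -> CK R)) : Prop :=
  forall V, act_open V -> V `<=` act_closure N -> V = set0.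

Definition act_meager (G : groupType) (R : realType) (M : set (G -> CK R -> CK R)) : Prop :=
  exists Ns : nat -> set (G -> CK R -> CK R),
    (forall k, act_nowhere_dense (Ns k)) /\ M `<=` \bigcup_k Ns k.

Definition act_comeager (G : groupType) (R : realType) (A : set (G -> CK R -> CK R)) : Prop :=
  act_meager (@Act G R `\` A).

Definition is_norm (R : realType) (N : CK R -> R) : Prop :=
  [/\ (forall f, 0 <= N f),
      (forall f, N f = 0 -> forall x, sval f x = 0),
      (forall (a : R) f h, (forall x, sval h x = a * sval f x) -> N h = `|a| * N f) &
      (forall f g h, (forall x, sval h x = sval f x + sval g x) -> N h <= N f + N g)].

Definition equiv_to_sup (R : realType) (N : CK R -> R) : Prop :=
  exists c C : R, [/\ 0 < c, 0 < C &
    forall f, c * supnorm (sval f) <= N f /\ N f <= C * supnorm (sval f)].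

Definition invariant_norm (G : groupType) (R : realType) (rho : G -> CK R -> CK R)
  (N : CK R -> R) : Prop :=
  forall g f, N (rho g f) = N f.

Definition strictly_convex (R : realType) (N : CK R -> R) : Prop :=
  forall f h m : CK R, f <> h -> N f = N h ->
    (forall x, sval m x = (sval f x + sval h x) / 2) -> N m < N f.

Definition admits_inv_strictly_convex_norm (G : groupType) (R : realType)
  (rho : G -> CK R -> CK R) : Prop :=
  exists N : CK R -> R,
    [/\ is_norm N, equiv_to_sup N, invariant_norm rho N & strictly_convex N].

(* Main.v *)
Require Import Defs.
From mathcomp Require Import all_boot all_order all_algebra.
From mathcomp Require Import all_classical all_reals all_analysis.
From mathcomp Require Import ring lra.
Set Implicit Arguments. Unset Strict Implicit. Unset Printing Implicit Defensive.
Import Order.TTheory GRing.Theory Num.Theory.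
Import numFieldTopology.Exports numFieldNormedType.Exports.
Local Open Scope classical_set_scope.
Local Open Scope ring_scope.

(**
By the Banach-Stone theorem an action [rho] acts on point evaluations by signed
permutations. Exhaust [G] by finite subgroups and average
the squares of signed point evaluations over them; the limit along a free
ultrafilter is a [G]-invariant quadratic form [q], and [sqrt (sup^2 + q)] is an
equivalent invariant norm, strictly convex as soon as [q] is definite. If [G] is
finite, [q] is always definite. If [G] is infinite, [q] is definite as soon as every
cylinder has finitely many translates covering the Cantor space [X], which for each
cylinder is an open condition.

It is also dense. Given [rho], finitely many functions and a finite subgroup [H],
choose [M] such that [rho h f] is nearly constant on cylinders of length [M], and a
finite subgroup [K] containing [H] with index at least [2^M]. As an [H]-set, [K] is
free with enough orbits to admit an [H]-equivariant map to (signed) points of [X]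
which meets every cylinder of length [M]. Splitting [X] into clopen copies of itself
indexed by [K], compatibly with that map, makes [K] act on [X] by permuting the
pieces transitively, and coinduction extends this to [G] without moving the pieces.
The resulting action is close to [rho] on [H], and any piece has [K]-translates
covering [X].
*)

(** * Cantor space and free ultrafilters *)

Local Notation X := cantor_space.

Definition agree (n : nat) (x y : nat -> bool) : Prop :=
  forall i, (i < n)%N -> x i = y i.

Lemma agree_sym n x y : agree n x y -> agree n y x.
Proof. by move=> xy i /xy. Qed.

Lemma agree_trans n y x z : agree n x y -> agree n y z -> agree n x z.
Proof. by move=> xy yz i ni; rewrite xy // yz. Qed.

Lemma agree_leq n m x y : (n <= m)%N -> agree m x y -> agree n x y.
Proof. by move=> nm xy i ni; apply: xy; exact: leq_trans nm. Qed.

(** The cylinders around [x] generate a filter converging to [x] coordinatewise; conversely,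
    continuity of the projections fixes one bit at a time. *)
Lemma nbhs_cantorP (x : X) (A : set X) :
  nbhs x A <-> exists n, forall y : X, agree n x y -> A y.
Proof.
pose B (n : nat) : set X := [set y : X | agree n x y].
pose F := filter_from [set: nat] B.
have FF : ProperFilter F.
  apply: filter_from_proper; last by move=> n _; exists x.
  apply: filter_from_filter; first by exists 0%N.
  move=> i j _ _; exists (maxn i j) => // y xy; split.
    by apply: agree_leq xy; rewrite leq_maxl.
  by apply: agree_leq xy; rewrite leq_maxr.
split.
- have : F --> (x : prod_topology (fun _ : nat => bool)).
    apply/pointwise_cvgP => t U /=; rewrite nbhs_principalE principal_filterP => Ux.
    exists t.+1 => // y /(_ t (ltnSn t)) xy.
    by rewrite /= -xy; exact: Ux.
  by move=> h /h [n _ nA]; exists n => y /nA.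
- move=> [n nA]; apply: filterS nA _.
  elim: n => [|n IH]; first by apply: filterS filterT => y _ i.
  have Hn : nbhs x [set y : X | x n = y n].
    have := @proj_continuous nat (fun=> bool) n x.
    move=> /(_ [set x n]); rewrite nbhs_principalE => /(_ _) /=.
    rewrite principal_filterP => /(_ erefl).
    by apply: filterS => y /= ->.
  apply: filterS2 IH Hn => y xy xyn i; rewrite ltnS leq_eqVlt.
  by case/predU1P => [->//|/xy].
Qed.

Lemma free_ultrafilter : exists F : set_system nat,
  UltraFilter F /\ forall n, F [set k | (n <= k)%N].
Proof.
have [F [FU oF]] := ultraFilterLemma (eventually_filter).
exists F; split=> // n; apply: oF; exact: nbhs_infty_ge.
Qed.

(** Compactness along an ultrafilter: each bit of the limit is the value that [F] sees almost
    always. *)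
Lemma cantor_ultralim (F : set_system nat) (u : nat -> X) : UltraFilter F ->
  exists x : X, forall n, F [set k | agree n x (u k)].
Proof.
move=> FU; pose x : X := fun i => `[< F [set k | u k i] >].
exists x; elim=> [|n IH]; first by apply: filterS filterT => k _ i.
have Fn : F [set k | x n = u k n].
  rewrite /x; case: asboolP => [|nFn]; first by apply: filterS => k /= ->.
  have [//|] := in_ultra_setVsetC [set k | u k n] FU.
  by apply: filterS => k /= /negP/negPf ->.
apply: filterS2 IH Fn => k xk xn i; rewrite ltnS leq_eqVlt.
by case/predU1P => [->//|/xk].
Qed.

(** * Uniform continuity, boundedness and limits along ultrafilters *)

Section UniformContinuity.
Variable R : realType.

Definition ucont (f : X -> R) : Prop :=
  forall e : R, 0 < e -> exists n, forall x y : X, agree n x y -> `|f x - f y| < e.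

Lemma ucont_continuous (f : X -> R) : ucont f -> continuous f.
Proof.
move=> fu x; apply/cvgrPdist_lt => e /fu [n nP].
by apply/nbhs_cantorP; exists n => y /nP.
Qed.

(** Otherwise pairs agreeing to depth [k] but with values [e] apart would both tend to one
    ultralimit [z], where continuity brings their values together. *)
Lemma continuous_ucont (f : X -> R) : continuous f -> ucont f.
Proof.
move=> fc e e0; apply/not_existsP => H.
have {}H n : exists xy : X * X, agree n xy.1 xy.2 /\ e <= `|f xy.1 - f xy.2|.
  apply: contrapT => nH; apply: (H n) => x y xy.
  by rewrite ltNge; apply/negP => exy; apply: nH; exists (x, y).
have [uv uvP] := choice H.
have [F [FU Fge]] := free_ultrafilter.
have [z zP] := cantor_ultralim (fst \o uv) FU.
have e2 : 0 < e / 2 by rewrite divr_gt0.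
have /cvgrPdist_lt /(_ _ e2) /nbhs_cantorP[n nP] := fc z.
have : F [set k | False].
  apply: filterS2 (zP n) (Fge n) => k zk nk.
  have [uvk] := uvP k; apply/negP; rewrite -ltNge.
  have := nP _ zk; have := nP (uv k).2 _.
  move=> /(_ (agree_trans zk (agree_leq nk uvk))) /=.
  by rewrite !ltr_norml => /andP[? ?] /andP[? ?]; apply/andP; split; lra.
by move=> /filter_ex [].
Qed.

Lemma continuous_bounded (f : X -> R) : continuous f ->
  exists B, forall x, `|f x| <= B.
Proof.
move=> /continuous_ucont fu; apply/not_existsP => H.
have {}H n : exists x : X, n%:R < `|f x|.
  apply: contrapT => nH; apply: (H n%:R) => x.
  by rewrite leNgt; apply/negP => nx; apply: nH; exists x.
have [u uP] := choice H.
have [F [FU Fge]] := free_ultrafilter.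
have [z zP] := cantor_ultralim u FU.
have [n nP] := fu 1 ltr01.
pose m := (Num.truncn (`|f z| + 1)).+1.
have : F [set k | False].
  apply: filterS2 (zP n) (Fge m) => k zk mk.
  have /= := nP _ _ zk; apply/negP; rewrite -leNgt.
  have := uP k; have : `|f z| + 1 < m%:R by exact: truncnS_gt.
  have : (m%:R : R) <= k%:R by rewrite ler_nat.
  have := ler_normB (f (u k) - f z) (- f z).
  rewrite opprK subrK normrN (distrC (f z)); lra.
by move=> /filter_ex [].
Qed.

(** The image ultrafilter lives on a compact interval. *)
Lemma ultralim_real (F : set_system nat) (u : nat -> R) (B : R) :
  UltraFilter F -> (forall n, `|u n| <= B) -> cvg (u @ F).
Proof.
move=> FU uB.
have uF : F (u @^-1` `[- B, B]).
  apply: filterS filterT => n _; have := uB n.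
  by rewrite ler_norml /= in_itv.
have uU : UltraFilter (u @ F).
  split=> [|G GP uG]; first exact: fmap_proper_filter.
  apply/seteqP; split=> // A GA.
  have [//|nFA] := in_ultra_setVsetC (u @^-1` A) FU.
  have /(filterI GA) : G (~` A) by exact: uG.
  by rewrite setICr => /filter_ex[].
have := @segment_compact R (- B) B; rewrite compact_ultra => /(_ (u @ F) uU uF).
by case=> p [_ up]; apply/cvg_ex; exists p.
Qed.

End UniformContinuity.

(** * Pointwise Banach-Stone theorem *)

Section CantorFunctions.
Variable R : realType.
Implicit Types (f g h : CK R).

Definition mkCK (f : X -> R) (fu : ucont f) : CK R :=
  exist _ f (ucont_continuous fu).

Lemma CK_ucont f : ucont (sval f).
Proof. exact: continuous_ucont (svalP f). Qed.

Lemma CK_ext f g : (forall x, sval f x = sval g x) -> f = g.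
Proof.
case: f g => [f fc] [g gc] /= fg.
by have {}fg : f = g by [exact/funext]; subst g; congr exist; exact: Prop_irrelevance.
Qed.

Lemma supnorm_ub f x : `|sval f x| <= supnorm (sval f).
Proof.
have [B BP] := continuous_bounded (svalP f).
apply: sup_ubound; last by exists x.
by exists B => _ [y _ <-].
Qed.

Lemma supnorm_le (f : X -> R) B : (forall x, `|f x| <= B) -> supnorm f <= B.
Proof.
move=> fB; apply: sup_le_ub; last by move=> _ [y _ <-].
by exists `|f point|; exists point.
Qed.

Lemma supnorm_ge0 f : 0 <= supnorm (sval f).
Proof. exact: le_trans (supnorm_ub f point). Qed.

Lemma supnorm_approx f e : 0 < e -> exists x, supnorm (sval f) - e < `|sval f x|.
Proof.
move=> e0; apply: contrapT => /forallNP H.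
have : supnorm (sval f) <= supnorm (sval f) - e.
  by apply: supnorm_le => x; rewrite leNgt; apply/negP.
by rewrite lerBrDl gerDr leNgt e0.
Qed.

Lemma lincomb_continuous (a : R) f g :
  continuous (fun x : X => a * sval f x + sval g x).
Proof.
move=> x; apply: cvgD; last exact: (svalP g).
by apply: cvgM; [exact: cvg_cst|exact: (svalP f)].
Qed.

Definition lincomb (a : R) f g : CK R := exist _ _ (@lincomb_continuous a f g).

Lemma cst_ucont (c : R) : ucont (fun _ : X => c).
Proof. by move=> e e0; exists 0%N => x y _; rewrite subrr normr0. Qed.

Definition cstCK (c : R) : CK R := mkCK (cst_ucont c).

Lemma cyl_ucont n (x : X) : ucont (fun y : X => (`[< agree n x y >])%:R : R).
Proof.
move=> e e0; exists n => y z yz.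
suff -> : `[< agree n x y >] = `[< agree n x z >] by rewrite subrr normr0.
apply: asbool_equiv_eq; split => H; first exact: agree_trans yz.
exact: agree_trans (agree_sym yz).
Qed.

Definition cyl n x : CK R := mkCK (cyl_ucont n x).

Lemma cyl_in n x y : agree n x y -> sval (cyl n x) y = 1.
Proof. by move=> xy /=; rewrite asboolT. Qed.

Lemma cyl_gt0 n x y : 0 < `|sval (cyl n x) y| -> agree n x y.
Proof. by rewrite /=; case: asboolP => //; rewrite normr0 ltxx. Qed.

Section Isometry.
Variables (T : CK R -> CK R) (Tiso : is_lin_iso T).

Lemma iso_lin a f g x : sval (T (lincomb a f g)) x = a * sval (T f) x + sval (T g) x.
Proof. by case: Tiso => + _ _; apply. Qed.

Lemma iso_norm f : supnorm (sval (T f)) = supnorm (sval f).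
Proof. by case: Tiso. Qed.

(* If [k_n] is the preimage of the indicator of the [n]-cylinder around [x0] and
   [y_n] almost maximises [|k_n|], then [1 + |f y_n| <= ||k_n +- f|| + o(1)] is
   bounded by [1 + sup |T f|] over that cylinder. *)
Lemma iso_point_le (x0 : X) :
  exists y : X, forall f, `|sval f y| <= `|sval (T f) x0|.
Proof.
have Hk n : exists ky : CK R * X,
    T ky.1 = cyl n x0 /\ 1 - n.+1%:R^-1 < `|sval ky.1 ky.2|.
  case: Tiso => _ _ /(_ (cyl n x0)) [k kE].
  have n0 : 0 < n.+1%:R^-1 :> R by rewrite invr_gt0.
  have [y yP] := supnorm_approx k n0.
  exists (k, y); split => //=; apply: le_lt_trans yP; rewrite lerD2r.
  rewrite -iso_norm kE; apply: le_trans (supnorm_ub _ x0).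
  by rewrite cyl_in // normr1.
have [ky kyP] := choice Hk.
have [F [FU Fge]] := free_ultrafilter.
have [y yP] := cantor_ultralim (snd \o ky) FU; exists y.
have small f : supnorm (sval f) <= 1 -> `|sval f y| <= `|sval (T f) x0|.
  move=> f1; apply/ler_addgt0Pl => e e0.
  have e3 : 0 < e / 3 by rewrite divr_gt0.
  have [n nP] := CK_ucont (T f) e3.
  have [m mP] := CK_ucont f e3.
  pose N := maxn n (Num.truncn (3 / e)).
  have [k [/mP /= fk Nk]] := filter_ex (filterI (yP m) (Fge N)).
  have [Tk kk] := kyP k.
  move: Tk kk fk; set k' := (ky k).1; set y' := (ky k).2 => Tk kk fk.
  have kinv : k.+1%:R^-1 < e / 3 :> R.
    rewrite -[ltRHS]invf_div ltf_pV2 ?posrE ?divr_gt0 //.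
    apply: lt_le_trans (truncnS_gt _) _; rewrite ler_nat ltnS.
    by apply: leq_trans Nk; rewrite leq_maxr.
  have Hs (s : R) : `|s| <= 1 ->
      `|s * sval f y' + sval k' y'| <= 1 + `|sval (T f) x0| + e / 3.
    move=> s1; apply: le_trans (supnorm_ub (lincomb s f k') y') _.
    rewrite -iso_norm; apply: supnorm_le => x.
    rewrite iso_lin Tk.
    have sT : `|s * sval (T f) x| <= `|sval (T f) x|.
      by rewrite normrM ler_piMl.
    apply: le_trans (ler_normD _ _) _.
    have [xx|xx] := pselect (agree k x0 x).
      rewrite cyl_in // normr1.
      have nx : agree n x0 x.
        by apply: agree_leq xx; apply: leq_trans Nk; rewrite leq_maxl.
      have := nP _ _ nx; rewrite distrC.
      have := ler_normB (sval (T f) x0 - sval (T f) x) (sval (T f) x0).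
      have := ler_normD (sval (T f) x - sval (T f) x0) (sval (T f) x0).
      rewrite subrK; lra.
    have -> : sval (cyl k x0) x = 0 by rewrite /= asboolF.
    rewrite normr0 addr0; apply: le_trans sT _.
    apply: (le_trans (supnorm_ub _ _)); rewrite iso_norm.
    have : 0 <= `|sval (T f) x0| by []. lra.
  (* One of the signs [1] and [- 1] aligns [s * sval f y'] with [sval k' y']. *)
  have key : `|sval f y'| + `|sval k' y'| <= 1 + `|sval (T f) x0| + e / 3.
    have := Hs 1; have := Hs (- 1); rewrite normrN !normr1 lexx.
    move=> /(_ isT) + /(_ isT); rewrite mulN1r mul1r.
    by case: (ler0P (sval f y')); case: (ler0P (sval k' y'));
       rewrite !ler_norml => ? ? /andP[? ?] /andP[? ?]; lra.
  have := ler_normD (sval f y - sval f y') (sval f y').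
  rewrite subrK; move: kk kinv; set d := _^-1 => kk kinv; lra.
(* The general case follows by scaling into the unit ball; the [+ 1] keeps the denominator
   positive. *)
move=> f; pose c := (supnorm (sval f) + 1)^-1.
have s0 := supnorm_ge0 f.
have c0 : 0 < c by rewrite invr_gt0; lra.
have := small (lincomb c f (cstCK 0)); rewrite iso_lin /=.
have T0 : sval (T (cstCK 0)) x0 = 0.
  apply/eqP; rewrite -normr_le0; apply: le_trans (supnorm_ub _ _) _.
  by rewrite iso_norm; apply: supnorm_le => x; rewrite normr0.
rewrite T0 !addr0 !normrM (gtr0_norm c0) ler_pM2l //; apply.
apply: supnorm_le => x; rewrite /= addr0 normrM (gtr0_norm c0) /c.
rewrite mulrC ler_pdivrMr; last by lra.
by have := supnorm_ub f x; lra.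
Qed.

(** By [iso_point_le], [f] vanishes at [y] once [T f] vanishes at [x0]; this is applied to [f] minus
    the constant that cancels [T f] at [x0]. *)
Lemma banach_stone_point (x0 : X) : exists sy : R * X,
  sy.1 * sy.1 = 1 /\ forall f, sval (T f) x0 = sy.1 * sval f sy.2.
Proof.
have [y yP] := iso_point_le x0.
pose s := sval (T (cstCK 1)) x0.
have s1 : `|s| = 1.
  apply/le_anti/andP; split; last by have := yP (cstCK 1); rewrite /= normr1.
  apply: le_trans (supnorm_ub _ _) _; rewrite iso_norm.
  by apply: supnorm_le => x; rewrite /= normr1.
have ss : s * s = 1 by rewrite -expr2 -real_normK ?num_real // s1 expr1n.
exists (s, y); split => //= f.
have := yP (lincomb (- (s * sval (T f) x0)) (cstCK 1) f).
rewrite iso_lin -/s /= mulr1.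
have -> : - (s * sval (T f) x0) * s + sval (T f) x0 = 0.
  by rewrite mulNr mulrAC ss mul1r addNr.
rewrite normr0 normr_le0 addrC subr_eq0 => /eqP ->.
by rewrite mulrA ss mul1r.
Qed.

End Isometry.
End CantorFunctions.

(** * Strictly convex norms from quadratic forms *)

Section NormOfForm.
Variable R : realType.
Implicit Types (f g h d k l m : CK R).

Lemma supnormZ (a : R) f h : (forall x, sval h x = a * sval f x) ->
  supnorm (sval h) = `|a| * supnorm (sval f).
Proof.
have le (b : R) k l : (forall x, sval l x = b * sval k x) ->
    supnorm (sval l) <= `|b| * supnorm (sval k).
  move=> lk; apply: supnorm_le => x; rewrite lk normrM.
  by apply: ler_wpM2l => //; exact: supnorm_ub.
move=> hf; apply/le_anti/andP; split; first exact: le.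
have [a0|a0] := eqVneq a 0; first by rewrite a0 normr0 mul0r supnorm_ge0.
rewrite -ler_pdivlMl ?normr_gt0 // -normfV; apply: le => x.
by rewrite hf mulrA mulVf // mul1r.
Qed.

Variables (G : groupType) (rho : G -> CK R -> CK R) (q : CK R -> R).
Hypotheses (rhoA : is_action rho) (q_ge0 : forall f, 0 <= q f).
Hypothesis q_le : forall f, q f <= supnorm (sval f) ^+ 2.
(** The parallelogram law for convex combinations: an exact identity, hence stable under limits,
    whose last term measures strict convexity. *)
Hypothesis q_conv : forall (t : R) f g h d,
  (forall x, sval h x = (1 - t) * sval f x + t * sval g x) ->
  (forall x, sval d x = sval f x - sval g x) ->
  q h = (1 - t) * q f + t * q g - t * (1 - t) * q d.
Hypothesis q_hom : forall (a : R) f h,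
  (forall x, sval h x = a * sval f x) -> q h = a ^+ 2 * q f.
Hypothesis q_inv : forall (k : G) f, q (rho k f) = q f.
Hypothesis q_def : forall f, q f = 0 -> forall x, sval f x = 0.

Let Q f := supnorm (sval f) ^+ 2 + q f.

Let Q_ge0 f : 0 <= Q f.
Proof. by rewrite addr_ge0 ?sqr_ge0. Qed.

Let Q_conv (t : R) f g h d : 0 <= t <= 1 ->
  (forall x, sval h x = (1 - t) * sval f x + t * sval g x) ->
  (forall x, sval d x = sval f x - sval g x) ->
  Q h <= (1 - t) * Q f + t * Q g - t * (1 - t) * q d.
Proof.
move=> /andP[t0 t1] hE dE; rewrite /Q (q_conv hE dE).
have sh : supnorm (sval h) <= (1 - t) * supnorm (sval f) + t * supnorm (sval g).
  apply: supnorm_le => x; rewrite hE.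
  apply: le_trans (ler_normD _ _) _; rewrite !normrM (ger0_norm t0).
  have t2 : 0 <= 1 - t by lra.
  by rewrite (ger0_norm t2) lerD // ler_wpM2l //; exact: supnorm_ub.
have := supnorm_ge0 h; have := supnorm_ge0 f; have := supnorm_ge0 g.
move: sh; set u := supnorm (sval f); set v := supnorm (sval g).
set w := supnorm (sval h) => wle v0 u0 w0.
have w2 : w ^+ 2 <= ((1 - t) * u + t * v) ^+ 2 by rewrite lerXn2r // nnegrE; lra.
have tt : 0 <= t * (1 - t) by rewrite mulr_ge0 //; lra.
(* This product is exactly the convexity defect of squaring at [u] and [v]. *)
have := mulr_ge0 tt (sqr_ge0 (u - v)).
nra.
Qed.

Let Q_hom (a : R) f h : (forall x, sval h x = a * sval f x) -> Q h = a ^+ 2 * Q f.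
Proof.
move=> hf; rewrite /Q (q_hom hf) (supnormZ hf) exprMn real_normK ?num_real //.
by rewrite mulrDr.
Qed.

Let Q_def f : Q f = 0 -> forall x, sval f x = 0.
Proof.
move=> Q0; apply: q_def; apply: le_anti; rewrite q_ge0 andbT -Q0.
by rewrite lerDr sqr_ge0.
Qed.

Let N f := Num.sqrt (Q f).

(** The unit ball of [Q] is convex, and [(f + g) / (a + b)] is the combination of [f / a] and
    [g / b] with weight [b / (a + b)] on the latter. The cases [a = 0] and [b = 0] are treated
    apart. *)
Let N_tri f g h : (forall x, sval h x = sval f x + sval g x) -> N h <= N f + N g.
Proof.
move=> hE; set a := N f; set b := N g.
have a2 : a ^+ 2 = Q f by rewrite sqr_sqrtr.
have b2 : b ^+ 2 = Q g by rewrite sqr_sqrtr.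
have a0 : 0 <= a by exact: sqrtr_ge0.
have b0 : 0 <= b by exact: sqrtr_ge0.
have [az|an] := eqVneq a 0.
  have f0 := Q_def (etrans (esym a2) (etrans (congr1 (fun z => z ^+ 2) az) (expr0n _ _))).
  have -> : h = g by apply: CK_ext => x; rewrite hE f0 add0r.
  by rewrite -/b lerDr.
have [bz|bn] := eqVneq b 0.
  have g0 := Q_def (etrans (esym b2) (etrans (congr1 (fun z => z ^+ 2) bz) (expr0n _ _))).
  have -> : h = f by apply: CK_ext => x; rewrite hE g0 addr0.
  by rewrite -/a lerDl.
have {}a0 : 0 < a by rewrite lt_neqAle eq_sym an.
have {}b0 : 0 < b by rewrite lt_neqAle eq_sym bn.
have ab0 : 0 < a + b by exact: addr_gt0.
have abn : a + b != 0 by exact: lt0r_neq0.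
pose z := cstCK (0 : R).
pose f' := lincomb a^-1 f z; pose g' := lincomb b^-1 g z.
pose h' := lincomb (a + b)^-1 h z; pose d := lincomb (- 1) g' f'.
have Qf : Q f' = 1.
  rewrite (@Q_hom a^-1 f) => [|x]; last by rewrite /= addr0.
  by rewrite -a2 exprVn mulVf // expf_neq0.
have Qg : Q g' = 1.
  rewrite (@Q_hom b^-1 g) => [|x]; last by rewrite /= addr0.
  by rewrite -b2 exprVn mulVf // expf_neq0.
have t01 : 0 <= b / (a + b) <= 1.
  apply/andP; split; first by apply: divr_ge0; exact: ltW.
  by rewrite ler_pdivrMr // mul1r lerDr ltW.
have /(_ t01) := @Q_conv (b / (a + b)) f' g' h' d.
rewrite Qf Qg !mulr1 subrK => H.
have Qh : Q h' <= 1.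
  apply: le_trans (H _ _) _ => [x|x|].
  - by rewrite /= !addr0 hE; field; rewrite abn an bn.
  - by rewrite /=; ring.
  - by rewrite gerBl mulr_ge0 // mulr_ge0; lra.
move: Qh; rewrite (@Q_hom (a + b)^-1 h) => [|x]; last by rewrite /= addr0.
rewrite exprVn mulrC ler_pdivrMr ?exprn_gt0 // mul1r => Qh.
by rewrite -(ger0_norm (ltW ab0)) -sqrtr_sqr ler_wsqrtr.
Qed.

(** For equal norms, convexity at [t = 1/2] gives [Q m <= Q f - q d / 4], which definiteness of [q]
    makes strict. Equivalence holds as [q] lies between [0] and the squared sup norm. *)
Lemma strictly_convex_norm_of_form : admits_inv_strictly_convex_norm rho.
Proof.
exists N; split.
- split=> [f|f /eqP|a f h hf|f g h]; first exact: sqrtr_ge0.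
  + rewrite sqrtr_eq0 => Q0; apply: Q_def.
    by apply: le_anti; rewrite Q0 Q_ge0.
  + by rewrite /N (Q_hom hf) sqrtrM ?sqr_ge0 // sqrtr_sqr.
  + exact: N_tri.
- exists 1, (Num.sqrt 2); split => [//||f]; first by rewrite sqrtr_gt0.
  have s0 := supnorm_ge0 f; rewrite mul1r; split.
    rewrite -{1}(ger0_norm s0) -sqrtr_sqr ler_wsqrtr //.
    by rewrite lerDl.
  rewrite -{1}(ger0_norm s0) -sqrtr_sqr -sqrtrM // ler_wsqrtr //.
  by have := q_le f; rewrite /Q; lra.
- move=> g f; rewrite /N /Q q_inv; case: rhoA => /(_ g) riso _.
  by rewrite (iso_norm riso).
- move=> f h m fh Nfh mE.
  have Qfh : Q f = Q h by rewrite -[LHS]sqr_sqrtr // -[RHS]sqr_sqrtr // -/(N f) Nfh.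
  pose d := lincomb (- 1) h f.
  have dE x : sval d x = sval f x - sval h x by rewrite /=; ring.
  have qd : 0 < q d.
    rewrite lt_neqAle q_ge0 andbT; apply/eqP => q0; apply: fh; apply: CK_ext => x.
    by have := q_def (esym q0) x; rewrite dE => /eqP; rewrite subr_eq0 => /eqP.
  have := @Q_conv 2^-1 f h m d _ _ dE; rewrite -Qfh => Qm.
  have lt : Q m < Q f.
    apply: le_lt_trans (Qm _ _) _; [lra|by move=> x; rewrite mE; field|].
    lra.
  by rewrite /N ltr_sqrt // (le_lt_trans (Q_ge0 m)).
Qed.

End NormOfForm.

(** * Averaging over finite subgroups *)

Lemma uniform_bound (T : eqType) (P : T -> nat -> Prop) (s : seq T) :
  (forall t m m', (m <= m')%N -> P t m -> P t m') ->
  (forall t, exists m, P t m) -> exists m, forall t, t \in s -> P t m.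
Proof.
move=> Pmono Pex; elim: s => [|t s [m mP]]; first by exists 0%N.
have [m' m'P] := Pex t; exists (maxn m m') => u; rewrite inE => /predU1P[->|us].
  by apply: Pmono m'P; exact: leq_maxr.
by apply: Pmono (mP _ us); exact: leq_maxl.
Qed.

Section FiniteSubgroups.
Variable G : groupType.

Definition fin_subgroup (s : seq G) : Prop :=
  [/\ uniq s, (1%g \in s), (forall x y, x \in s -> y \in s -> (x * y)%g \in s) &
      (forall x, x \in s -> (x^-1)%g \in s)].

Lemma fin_subgroup_exists (Glf : locally_finite G) (l : seq G) :
  exists s, fin_subgroup s /\ {subset l <= s}.
Proof.
have /finite_seqP[s sE] := Glf [set` l] (finite_seq l).
have sP x : (x \in undup s) <-> gen_subgroup [set` l] x.
  by rewrite mem_undup sE.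
exists (undup s); split; last by move=> x xl; apply/sP => A [+ _ _ _]; apply.
split.
- exact: undup_uniq.
- by apply/sP => A [].
- move=> x y /sP xs /sP ys; apply/sP => A AP.
  by have [_ _ + _] := AP; apply; [exact: xs|exact: ys].
- move=> x /sP xs; apply/sP => A AP.
  by have [_ _ _] := AP; apply; exact: xs.
Qed.

(** A left inverse [e] of an injection into the integers enumerates [G], and [H n] contains its
    first [n] values. *)
Lemma exhausting_subgroups (Gcount : countable [set: G]) (Glf : locally_finite G) :
  exists H : nat -> seq G, (forall n, fin_subgroup (H n)) /\
    forall g, exists m, forall n, (m <= n)%N -> g \in H n.
Proof.
have /countable_injP[f finj] := Gcount.
have /choice[e eP] : forall i, exists g, (exists g', f g' = i) -> f g = i.
  move=> i; have [[g gi]|no] := pselect (exists g', f g' = i); first by exists g.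
  by exists 1%g.
have /choice[H HP] n := fin_subgroup_exists Glf (map e (iota 0 n)).
exists H; split => [n|g]; first by case: (HP n).
exists (f g).+1 => n fn; have [_] := HP n; apply.
have -> : g = e (f g) by apply: finj; rewrite ?inE // eP //; exists g.
by rewrite map_f // mem_iota.
Qed.

Lemma sumr_cst_seq (R : realType) (s : seq G) (c : R) :
  \sum_(a <- s) c = (size s)%:R * c.
Proof. by rewrite big_const_seq count_predT iter_addr_0 mulr_natl. Qed.

Lemma big_fin_subgroup_mulr (R : realType) (s : seq G) (g : G) (P : G -> R) :
  fin_subgroup s -> g \in s -> \sum_(h <- s) P (h * g)%g = \sum_(h <- s) P h.
Proof.
move=> [us s1 sM sV] gs.
rewrite -(big_map (fun h => h * g)%g xpredT P); apply: perm_big.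
apply: uniq_perm => [||x] //.
  by rewrite map_inj_uniq // => x y /mulIg.
apply/mapP/idP => [[y ys ->]|xs]; first exact: sM.
by exists (x * g^-1)%g; rewrite ?sM ?sV // -mulgA mulVg mulg1.
Qed.

End FiniteSubgroups.

Definition word_point (w : seq bool) : X := nth false w.

(** Finite words continued by [false] form a countable dense set; undecodable codes give the empty
    word. *)
Definition dense_seq (k : nat) : X := word_point (odflt [::] (unpickle k)).

Lemma dense_seqP n (x : X) : exists k, agree n x (dense_seq k).
Proof.
exists (pickle (mkseq x n)) => i ni.
by rewrite /dense_seq pickleK /= /word_point nth_mkseq.
Qed.

(** * The averaged quadratic form and criteria for its definiteness *)

Section AveragedForm.
Variables (R : realType) (G : groupType) (rho : G -> CK R -> CK R).
Hypothesis rhoA : is_action rho.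
Implicit Types (f g h d : CK R) (x y : X) (a b : G).

Lemma action_iso a : is_lin_iso (rho a). Proof. by case: rhoA. Qed.

Lemma actionM a b f : rho (a * b)%g f = rho a (rho b f).
Proof. by case: rhoA. Qed.

Lemma action1 f : rho 1%g f = f.
Proof.
case: (action_iso 1%g) => _ _ /(_ f) [f' <-].
by rewrite -actionM mulg1.
Qed.

Lemma action_point a x : exists sy : R * X,
  sy.1 * sy.1 = 1 /\ forall f, sval (rho a f) x = sy.1 * sval f sy.2.
Proof. exact: banach_stone_point (action_iso a) x. Qed.

(** Squaring removes the Banach-Stone sign. *)
Lemma action_sqr a x : exists y, forall f, sval (rho a f) x ^+ 2 = sval f y ^+ 2.
Proof.
have [[s y] [/= ss syP]] := action_point a x.
by exists y => f; rewrite syP exprMn expr2 ss mul1r.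
Qed.

Variables (H : nat -> seq G) (Hsub : forall n, fin_subgroup (H n)).
Hypothesis Hexh : forall a, exists m, forall n, (m <= n)%N -> a \in H n.

Definition avg n f x : R :=
  (size (H n))%:R^-1 * \sum_(a <- H n) sval (rho a f) x ^+ 2.

(** A truncated series of total weight below [1]; every point of the dense sequence enters it for
    large [n]. *)
Definition wavg n f : R :=
  \sum_(k < n) 2^-1 ^+ k.+1 * avg n f (dense_seq k).

Let size_gt0 n : 0 < (size (H n))%:R :> R.
Proof. by rewrite ltr0n; case: (Hsub n) => _ + _ _; case: (H n). Qed.

Lemma avg_ge0 n f x : 0 <= avg n f x.
Proof.
rewrite mulr_ge0 ?invr_ge0 ?ler0n // sumr_ge0 // => a _; exact: sqr_ge0.
Qed.

Lemma avg_le n f x : avg n f x <= supnorm (sval f) ^+ 2.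
Proof.
rewrite /avg mulrC ler_pdivrMr // mulrC -(sumr_cst_seq (H n)).
apply: ler_sum => a _; have [y ->] := action_sqr a x.
by rewrite -real_normK ?num_real // lerXn2r ?nnegrE ?supnorm_ge0 ?supnorm_ub.
Qed.

Lemma wavg_ge0 n f : 0 <= wavg n f.
Proof. by rewrite sumr_ge0 // => k _; rewrite mulr_ge0 ?avg_ge0. Qed.

Lemma wavg_le n f : wavg n f <= supnorm (sval f) ^+ 2.
Proof.
have -> : supnorm (sval f) ^+ 2 = 1 * supnorm (sval f) ^+ 2 by rewrite mul1r.
apply: (@le_trans _ _ (\sum_(k < n) 2^-1 ^+ k.+1 * supnorm (sval f) ^+ 2)).
  by apply: ler_sum => k _; rewrite ler_wpM2l ?avg_le.
rewrite -mulr_suml ler_wpM2r ?sqr_ge0 //.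
suff -> : \sum_(k < n) 2^-1 ^+ k.+1 = 1 - 2^-1 ^+ n :> R by rewrite gerBl exprn_ge0.
elim: n => [|n IH]; first by rewrite big_ord0 expr0 subrr.
by rewrite big_ord_recr /= IH exprS; field.
Qed.

Lemma avg_conv n (t : R) f g h d x :
  (forall x, sval h x = (1 - t) * sval f x + t * sval g x) ->
  (forall x, sval d x = sval f x - sval g x) ->
  avg n h x = (1 - t) * avg n f x + t * avg n g x - t * (1 - t) * avg n d x.
Proof.
move=> hE dE; rewrite /avg.
have -> : \sum_(a <- H n) sval (rho a h) x ^+ 2 =
    \sum_(a <- H n) ((1 - t) * sval (rho a f) x ^+ 2 +
      t * sval (rho a g) x ^+ 2 - t * (1 - t) * sval (rho a d) x ^+ 2).
  apply: eq_bigr => a _; have [y yP] := action_sqr a x.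
  by rewrite !yP hE dE; ring.
by rewrite sumrB big_split /= -!mulr_sumr; ring.
Qed.

Lemma wavg_conv n (t : R) f g h d :
  (forall x, sval h x = (1 - t) * sval f x + t * sval g x) ->
  (forall x, sval d x = sval f x - sval g x) ->
  wavg n h = (1 - t) * wavg n f + t * wavg n g - t * (1 - t) * wavg n d.
Proof.
move=> hE dE; rewrite /wavg !mulr_sumr -big_split -sumrB /=.
by apply: eq_bigr => k _; rewrite (avg_conv _ _ hE dE); ring.
Qed.

Lemma wavg_hom n (c : R) f h : (forall x, sval h x = c * sval f x) ->
  wavg n h = c ^+ 2 * wavg n f.
Proof.
move=> hf; rewrite /wavg mulr_sumr; apply: eq_bigr => k _.
rewrite /avg [RHS]mulrCA; congr (_ * _); rewrite [RHS]mulrCA; congr (_ * _).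
rewrite mulr_sumr; apply: eq_bigr => a _.
by have [y yP] := action_sqr a (dense_seq k); rewrite !yP hf exprMn.
Qed.

Lemma wavg_inv n a f : a \in H n -> wavg n (rho a f) = wavg n f.
Proof.
move=> aH; apply: eq_bigr => k _; rewrite /avg; congr (_ * (_ * _)).
rewrite -[RHS](@big_fin_subgroup_mulr _ _ _ _
  (fun b => sval (rho b f) (dense_seq k) ^+ 2) (Hsub n) aH).
by apply: eq_bigr => b _; rewrite actionM.
Qed.

(** The form is the ultralimit of [wavg], invariant because each [a] lies in [H n] for almost all
    [n]. Definiteness could be lost in the limit; a lower bound uniform in [n] at one dense point
    prevents that. *)
Lemma admits_of_avg_pos :
  (forall f x, sval f x != 0 -> exists k (c : R) m, 0 < c /\
     forall n, (m <= n)%N -> c <= avg n f (dense_seq k)) ->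
  admits_inv_strictly_convex_norm rho.
Proof.
move=> Hpos; have [F [FU Fge]] := free_ultrafilter.
have cv f : cvg (wavg^~ f @ F).
  apply: (ultralim_real FU (B := supnorm (sval f) ^+ 2)) => n.
  by rewrite ger0_norm ?wavg_ge0 ?wavg_le.
pose q f := lim (wavg^~ f @ F).
have qP f : wavg^~ f @ F --> q f by exact: cv.
have limE f l : wavg^~ f @ F --> l -> q f = l by exact: cvg_lim.
apply: (@strictly_convex_norm_of_form R G rho q rhoA).
- by move=> f; apply: limr_ge => //; apply: nearW => n; exact: wavg_ge0.
- by move=> f; apply: limr_le => //; apply: nearW => n; exact: wavg_le.
- move=> t f g h d hE dE; apply: limE.
  under eq_fun do rewrite (wavg_conv _ hE dE).
  apply: cvgB; last by apply: cvgM; [exact: cvg_cst|].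
  by apply: cvgD; (apply: cvgM; [exact: cvg_cst|]).
- move=> c f h hE; apply: limE; under eq_fun do rewrite (wavg_hom _ hE).
  by apply: cvgM; [exact: cvg_cst|].
- move=> a f; apply: limE; apply: cvg_trans (qP f); apply: near_eq_cvg.
  have [m mP] := Hexh a; apply: filterS (Fge m) => n /mP aH.
  by rewrite wavg_inv.
- move=> f qf x; apply/eqP; apply/negP => /negP /Hpos[k [c [m [c0 cP]]]].
  have : 2^-1 ^+ k.+1 * c <= q f.
    apply: limr_ge => //; apply: filterS2 (Fge m) (Fge k.+1) => n /cP cn kn.
    rewrite /wavg (bigD1 (Ordinal kn)) //= -[leLHS]addr0.
    apply: lerD; first by rewrite ler_wpM2l.
    by rewrite sumr_ge0 // => i _; rewrite mulr_ge0 ?avg_ge0.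
  by rewrite qf leNgt mulr_gt0 ?exprn_gt0 // invr_gt0.
Qed.

(** The identity term alone contributes at least [1 / size s] of the squared value, since each [H m]
    has at most [size s] elements. *)
Lemma admits_of_finite (s : seq G) : (forall a, a \in s) ->
  admits_inv_strictly_convex_norm rho.
Proof.
move=> sT; apply: admits_of_avg_pos => f x fx.
have fx0 : 0 < `|sval f x| by rewrite normr_gt0.
have [n nP] := CK_ucont f fx0.
have [k /nP xk] := dense_seqP n x.
have fk : sval f (dense_seq k) != 0.
  by apply/eqP => fk; move: xk; rewrite fk subr0 ltxx.
have s0 : (0 < size s)%N by move: (sT 1%g); case: (s).
exists k, ((size s)%:R^-1 * sval f (dense_seq k) ^+ 2), 0%N; split.
  by rewrite mulr_gt0 ?invr_gt0 ?ltr0n // exprn_even_gt0.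
move=> m _; rewrite /avg.
have [um m1 _ _] := Hsub m.
have sm : (size (H m))%:R <= (size s)%:R :> R by rewrite ler_nat uniq_leq_size.
apply: ler_pM; rewrite ?invr_ge0 ?sqr_ge0 //.
  by rewrite lef_pV2 ?posrE ?size_gt0 ?ltr0n.
rewrite (bigD1_seq 1%g) //= action1 lerDl.
by rewrite sumr_ge0 // => a _; exact: sqr_ge0.
Qed.

(* [|rho a (cyl n x)|] only takes the values 0 and 1; the threshold [1/2] makes the
   condition visibly stable under perturbation of [rho]. *)
Definition covering n x : Prop := exists l : seq G, forall y,
  exists2 a, a \in l & 2^-1 <= `|sval (rho a (cyl R n x)) y|.

(** If [size l] translates of a cylinder on which [|f| >= c] cover [X], then a proportion of at
    least [1 / size l] of [H k] moves a given point into it; hence the bound [c ^ 2 / size l]. *)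
Lemma admits_of_covering : (forall n x, covering n x) ->
  admits_inv_strictly_convex_norm rho.
Proof.
move=> cov; apply: admits_of_avg_pos => f x fx.
pose c := `|sval f x| / 2.
have c0 : 0 < c by rewrite divr_gt0 ?normr_gt0.
have [n nP] := CK_ucont f c0.
have fc y : agree n x y -> c <= `|sval f y|.
  move=> /nP; rewrite /c; have := ler_normB (sval f x - sval f y) (- sval f y).
  by rewrite opprK subrK normrN; lra.
have [l lP] := cov n x.
have [m mP] : exists m, forall k, (m <= k)%N -> {subset l <= H k}.
  have [m mP] : exists m, forall a, a \in l -> forall k, (m <= k)%N -> a \in H k.
    apply: uniform_bound => // a m m' mm' mP k m'k.
    by apply: mP; exact: leq_trans m'k.
  by exists m => k mk a /mP; apply.
have l0 : 0 < (size l)%:R :> R.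
  by rewrite ltr0n; have [a] := lP x; case: (l).
exists 0%N, (c ^+ 2 / (size l)%:R), m; split.
  by rewrite divr_gt0 ?exprn_gt0.
move=> k /mP lH; set z := dense_seq 0.
rewrite ler_pdivrMr // /avg mulrAC -mulrA mulrC ler_pdivlMr //.
rewrite mulrC -(sumr_cst_seq (H k)).
(* Right translation by each [b] in [l] preserves the sum, so for each [a] the [b] that serves the
   point [y] of [a] is available. *)
have -> : (size l)%:R * \sum_(a <- H k) sval (rho a f) z ^+ 2 =
    \sum_(b <- l) \sum_(a <- H k) sval (rho (a * b)%g f) z ^+ 2.
  rewrite -sumr_cst_seq; apply: eq_big_seq => b bl; apply/esym.
  exact: (@big_fin_subgroup_mulr _ _ _ _ (fun a => sval (rho a f) z ^+ 2) _ (lH b bl)).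
rewrite exchange_big /=; apply: ler_sum => a _.
have [y yP] := action_sqr a z.
have [b bl by2] := lP y.
rewrite (big_rem b) //= -[leLHS]addr0 lerD //; last first.
  by rewrite sumr_ge0 // => ? _; exact: sqr_ge0.
have [y' y'P] := action_sqr (a * b)%g z.
rewrite y'P -[leRHS]real_normK ?num_real // lerXn2r ?nnegrE ?(ltW c0) //.
(* The threshold at [y] makes the cylinder function nonzero at [y'], which puts [y'] in the
   cylinder. *)
have cy : 0 < sval (cyl R n x) y' ^+ 2.
  rewrite -y'P actionM yP -real_normK ?num_real //.
  by rewrite exprn_gt0 //; apply: lt_le_trans by2.
apply: fc; apply: (@cyl_gt0 R); rewrite normr_gt0.
by apply: contraTneq cy => ->; rewrite expr0n ltxx.
Qed.

End AveragedForm.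

(** * Prefix codes and coinduced actions *)

Section CombCode.
Variable T : eqType.
Implicit Types (a j : T) (s : seq T) (x y : nat -> bool).

Definition stail x : nat -> bool := fun i => x i.+1.
Definition scons (b : bool) x : nat -> bool := fun i => if i is i'.+1 then x i' else b.

(* The complete prefix code [0, 10, 110, ..., 1..10, 1..11] indexed by [a :: s]. *)
Fixpoint comb_dec a s x : T :=
  if s is b :: s' then if x 0%N then comb_dec b s' (stail x) else a else a.

Fixpoint comb_rest s x : nat -> bool :=
  if s is _ :: s' then if x 0%N then comb_rest s' (stail x) else stail x else x.

Fixpoint comb_enc a s j x : nat -> bool :=
  if s is b :: s' then
    if j == a then scons false x else scons true (comb_enc b s' j x)
  else x.

Lemma comb_dec_in a s x : comb_dec a s x \in a :: s.
Proof.
elim: s a x => [|b s IH] a x /=; first by rewrite inE.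
by case: (x 0%N); rewrite inE ?eqxx // IH orbT.
Qed.

Lemma comb_dec_enc a s j x : j \in a :: s -> comb_dec a s (comb_enc a s j x) = j.
Proof.
elim: s a x => [|b s IH] a x /=; first by rewrite inE => /eqP.
rewrite in_cons; case: eqP => [->//|_ /= js] /=; exact: IH.
Qed.

Lemma comb_rest_enc a s j x : j \in a :: s -> comb_rest s (comb_enc a s j x) = x.
Proof.
elim: s a x => [|b s IH] a x //=.
rewrite in_cons; case: eqP => [->//|_ /= js] /=; exact: IH.
Qed.

Lemma comb_enc_dec a s x : uniq (a :: s) ->
  comb_enc a s (comb_dec a s x) (comb_rest s x) = x.
Proof.
elim: s a x => [|b s IH] a x // /andP[abs us] /=.
have xE c : x 0%N = c -> scons c (stail x) = x by move=> <-; apply/funext; case.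
case E: (x 0%N); last by rewrite eqxx xE.
case: eqP => [da|_]; first by rewrite -da comb_dec_in in abs.
by rewrite IH // xE.
Qed.

Lemma agree_stail n x y : agree n.+1 x y -> agree n (stail x) (stail y).
Proof. by move=> xy i ni; exact: xy. Qed.

Lemma agree_scons n b x y : agree n x y -> agree n (scons b x) (scons b y).
Proof. by move=> xy [|i] //= ni; apply: xy; exact: ltnW. Qed.

Lemma comb_dec_agree a s x y : agree (size s) x y -> comb_dec a s x = comb_dec a s y.
Proof.
elim: s a x y => [|b s IH] a x y //= xy.
by rewrite -(xy 0%N) //; case: (x 0%N) => //; apply: IH; exact: agree_stail.
Qed.

Lemma comb_rest_agree n s x y : agree (n + size s) x y ->
  agree n (comb_rest s x) (comb_rest s y).
Proof.
elim: s x y => [|b s IH] x y /=; first by rewrite addn0.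
rewrite addnS => xy; rewrite -(xy 0%N) //.
case: (x 0%N); first by apply: IH; exact: agree_stail.
by apply: agree_leq (agree_stail xy); exact: leq_addr.
Qed.

Lemma comb_enc_agree n a s j x y : agree n x y ->
  agree n (comb_enc a s j x) (comb_enc a s j y).
Proof.
elim: s a x y n => [|b s IH] a x y n //= xy.
by case: eqP => _; apply: agree_scons => //; exact: IH.
Qed.

(* Subdividing the cylinder of each word [u] of length [M] by the comb code indexed
   by the fibre over [u] of [j |-> p j] truncated to length [M]. *)
Lemma prefix_code (K : seq T) (p : T -> X) (M : nat) : uniq K ->
  (forall x : X, exists2 j, j \in K & agree M (p j) x) ->
  exists (kappa : X -> T) (enc : T -> X -> X) (rest : X -> X),
  [/\ forall x, kappa x \in K /\ agree M (p (kappa x)) x,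
      forall j x, j \in K -> kappa (enc j x) = j /\ rest (enc j x) = x,
      forall x, enc (kappa x) (rest x) = x,
      forall x y, agree (M + size K) x y -> kappa x = kappa y &
      forall n x y, (agree (n + (M + size K)) x y -> agree n (rest x) (rest y)) /\
        (agree n x y -> forall j, agree n (enc j x) (enc j y))].
Proof.
move=> uK surj; have [j0 _ _] := surj point.
pose fib (x : X) := [seq j <- K | `[< agree M (p j) x >]].
have fib_agree x y : agree M x y -> fib x = fib y.
  move=> xy; apply: eq_filter => j; apply: asbool_equiv_eq; split => jx.
    exact: agree_trans xy.
  exact: agree_trans (agree_sym xy).
pose hd x := head j0 (fib x); pose tl x := behead (fib x).
have fibE x : hd x :: tl x = fib x.
  have [j jK jx] := surj x.
  have : j \in fib x by rewrite mem_filter jK andbT; exact/asboolP.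
  by rewrite /hd /tl; case: (fib x).
have fibP x j : j \in hd x :: tl x -> j \in K /\ agree M (p j) x.
  by rewrite fibE mem_filter => /andP[/asboolP ? ->].
have size_tl x : (size (tl x) <= size K)%N.
  by rewrite size_behead (leq_trans (leq_pred _)) // size_filter count_size.
have hd_agree x y : agree M x y -> hd x = hd y by rewrite /hd => /fib_agree ->.
have tl_agree x y : agree M x y -> tl x = tl y by rewrite /tl => /fib_agree ->.
pose drp (x : X) : X := fun i => x (M + i)%N.
pose pre (u x : X) : X := fun i => if (i < M)%N then u i else x (i - M)%N.
have drp_agree n x y : agree (n + M) x y -> agree n (drp x) (drp y).
  by move=> xy i ni; apply: xy; rewrite addnC ltn_add2r.
have drp_pre u x : drp (pre u x) = x.
  by apply/funext => i; rewrite /drp /pre ltnNge leq_addr /= addKn.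
have pre_drp u x : agree M u x -> pre u (drp x) = x.
  move=> ux; apply/funext => i; rewrite /drp /pre.
  by case: ltnP => [/ux//|Mi]; rewrite subnKC.
have agree_pre u x : agree M u (pre u x) by move=> i Mi; rewrite /pre Mi.
exists (fun x => comb_dec (hd x) (tl x) (drp x)).
exists (fun j x => pre (p j) (comb_enc (hd (p j)) (tl (p j)) j x)).
exists (fun x => comb_rest (tl x) (drp x)).
split.
- by move=> x; apply: fibP; exact: comb_dec_in.
- move=> j x jK; rewrite drp_pre.
  (* The encoded point begins with the same [M] bits as [p j], so both use the same fibre. *)
  rewrite -(hd_agree _ _ (agree_pre (p j) _)) -(tl_agree _ _ (agree_pre (p j) _)).
  have jf : j \in hd (p j) :: tl (p j).
    by rewrite fibE mem_filter jK andbT; exact/asboolP.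
  by rewrite comb_dec_enc ?comb_rest_enc.
- move=> x; set j := comb_dec _ _ _.
  have [_ jx] := fibP _ _ (comb_dec_in (hd x) (tl x) (drp x)).
  rewrite (hd_agree _ _ jx) (tl_agree _ _ jx) comb_enc_dec ?pre_drp //.
  by rewrite fibE filter_uniq.
(* [M] bits fix the fibre, and its comb code reads at most [size K] more. *)
- move=> x y xy; have xyM : agree M x y by apply: agree_leq xy; exact: leq_addr.
  rewrite (hd_agree _ _ xyM) (tl_agree _ _ xyM); apply: comb_dec_agree.
  by apply: drp_agree; apply: agree_leq xy; rewrite addnC leq_add2l.
- move=> n x y; split => [xy|xy j].
    have xyM : agree M x y.
      by apply: agree_leq xy; rewrite addnCA leq_addr.
    rewrite (tl_agree _ _ xyM); apply: comb_rest_agree; apply: drp_agree.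
    by apply: agree_leq xy; rewrite -addnA leq_add2l addnC leq_add2l.
  move=> i ni; rewrite /pre; case: ltnP => // _.
  by apply: (comb_enc_agree _ _ _ xy); exact: leq_ltn_trans (leq_subr _ _) ni.
Qed.

End CombCode.

(** * Coinduction from a finite subgroup *)

Section Coinduction.
Variable G : groupType.

Lemma coset_rep (s : seq G) : fin_subgroup s -> exists r : G -> G,
  [/\ r 1%g = 1%g, forall g, ((r g)^-1 * g)%g \in s &
      forall g k, k \in s -> r (g * k)%g = r g].
Proof.
move=> [us s1 sM sV].
have sMr g k : k \in s -> ((g * k)%g \in s) = (g \in s).
  move=> ks; apply/idP/idP => [gk|gs]; last exact: sM.
  by rewrite -(mulgK k g) sM ?sV.
pose cl g := [set x | (x^-1 * g)%g \in s].
(* The choice depends on [g] only through its left coset; [s] itself is represented by [1]. *)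
exists (fun g => if g \in s then 1%g else xget 1%g (cl g)); split.
- by rewrite s1.
- move=> g; case: ifPn => gs; first by rewrite invg1 mul1g.
  have : exists x, cl g x by exists g; rewrite /cl /= mulVg.
  by move=> /(xgetPex 1%g); rewrite /cl.
- move=> g k ks; rewrite (sMr _ _ ks); case: ifP => // _; congr xget.
  by apply/seteqP; split => x; rewrite /cl /= mulgA (sMr _ _ ks).
Qed.

(** The bijection [k |-> (1, k)] on the first [M] integers extends, both complements being countably
    infinite. *)
Lemma index_bijection (Gcount : countable [set: G]) (S : set G) (M : nat) : S 1%g ->
  exists (delta : nat -> G * nat) (gamma : G -> nat -> nat),
  [/\ forall n, S (delta n).1, forall c i, S c -> delta (gamma c i) = (c, i),
      forall n, gamma (delta n).1 (delta n).2 = n &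
      forall i, (i < M)%N -> gamma 1%g i = i].
Proof.
move=> S1; pose B : set (G * nat) := [set ci | S ci.1].
pose Y : set (G * nat) := [set ci | ci.1 = 1%g /\ (ci.2 < M)%N].
have f0 : set_bij `I_M Y (fun k => (1%g : G, k)).
  split=> [k kM|i j _ _ [] //|[c i] [/= c1 iM]]; last by exists i; rewrite ?c1.
  by split.
have infD (T : Type) (C D : set T) (u : T -> nat) : u @` D `<=` `I_M ->
    [set: nat] `<=` u @` C -> infinite_set (C `\` D).
  move=> uD uC fCD; apply: infinite_nat.
  have : finite_set (u @` (C `\` D) `|` `I_M).
    by rewrite finite_setU; split => //; exact: finite_image.
  apply: sub_finite_set => n /uC[t Ct <-].
  have [Dt|nDt] := pselect (D t); first by right; apply: uD; exists t.
  by left; exists t.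
have Bc : (B `\` Y #= [set: nat])%card.
  apply: eq_card_nat.
    apply: (@sub_countable _ _ _ ([set: G] `*` [set: nat])).
      by apply: subset_card_le.
    by apply: countableX.
  apply: (infD _ _ _ snd) => [_ [[c i] [_ /= iM] <-] //|i _].
  by exists (1%g, i).
have Nc : ([set: nat] `\` `I_M #= [set: nat])%card.
  apply: eq_card_nat => //; apply: (infD _ _ _ id) => [_ [i iM <-] //|i _].
  by exists i.
have [f fE] := Pbij f0.
have YB : Y `<=` B by move=> [c i] [/= c1 _]; rewrite /B /= c1.
have [|d dE] := super_bij f (@subsetT _ `I_M) YB.
  by apply: card_eq_trans Nc _; rewrite card_eq_sym.
have [dB dinj dsurj] := @bij _ _ _ _ d.
have /choice[gam gamP] : forall ci : G * nat, exists n, S ci.1 -> d n = ci.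
  move=> ci; have [Sc|nSc] := pselect (S ci.1); last by exists 0%N.
  by have [n _ nci] := dsurj ci Sc; exists n.
exists d, (fun c i => gam (c, i)); split.
- by move=> n; exact: dB.
- by move=> c i Sc; rewrite gamP.
- move=> n; apply: dinj; rewrite ?inE // gamP; first by case: (d n).
  exact: dB.
- move=> i iM; apply: dinj; rewrite ?inE // gamP //.
  by rewrite dE ?inE // -fE.
Qed.

Lemma agree_coordinatewise (phi : X -> X) :
  (forall n, exists m, forall x y : X, agree m x y -> phi x n = phi y n) ->
  forall n, exists m, forall x y : X, agree m x y -> agree n (phi x) (phi y).
Proof.
move=> H; elim=> [|n [m mP]]; first by exists 0%N.
have [m' m'P] := H n; exists (maxn m m') => x y xy i.
rewrite ltnS leq_eqVlt => /predU1P[->|].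
  by apply: m'P; apply: agree_leq xy; exact: leq_maxr.
by apply: mP; apply: agree_leq xy; exact: leq_maxl.
Qed.

(* The [G]-space of maps [phi : G -> X] with [phi (g k) = ka k (phi g)] for [k] in
   [s], on which [(phi . a) g = phi (a g)]; a choice of coset representatives [c]
   makes it the product of copies of [X] over these, and [gamma] identifies this
   product with [X] so that the first [M] coordinates of [phi 1] are preserved. *)
Lemma coinduced_action (Gcount : countable [set: G]) (s : seq G) (M : nat)
    (ka : G -> X -> X) : fin_subgroup s ->
  (forall k l x, k \in s -> l \in s -> ka (k * l)%g x = ka l (ka k x)) ->
  (forall x, ka 1%g x = x) ->
  (forall k n, k \in s -> exists m, forall x y : X, agree m x y ->
     agree n (ka k x) (ka k y)) ->
  exists act : X -> G -> X,
  [/\ forall x, act x 1%g = x,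
      forall x a b, act (act x a) b = act x (a * b)%g,
      forall a n, exists m, forall x y : X, agree m x y -> agree n (act x a) (act y a) &
      forall x k, k \in s -> exists x' : X, agree M x x' /\ agree M (act x k) (ka k x')].
Proof.
move=> ss kaM ka1 kac; have [us s1 sM sV] := ss.
have [r [r1 rs rM]] := coset_rep ss.
have rs' g : (g^-1 * r g)%g \in s by have := sV _ (rs g); rewrite invgM invgK.
have rr g : r (r g) = r g by have := rM g _ (rs' g); rewrite mulVKg.
have [dl [gm [dlS dlgm gmdl gm1]]] := @index_bijection Gcount [set c | r c = c] M r1.
(* [co x c] is the value at the representative [c] of the map coded by [x]; [phi x] is its
   equivariant extension to [G]. *)
pose co (x : X) (c : G) : X := fun i => x (gm c i).
pose phi (x : X) (g : G) : X := ka ((r g)^-1 * g)%g (co x (r g)).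
pose act (x : X) (a : G) : X := fun n => phi x (a * (dl n).1)%g (dl n).2.
have co_act x a c : r c = c -> co (act x a) c = phi x (a * c)%g.
  by move=> rc; apply/funext => i; rewrite /co /act dlgm.
have rMr a g : r (a * r g)%g = r (a * g)%g.
  by have := rM (a * g)%g _ (rs' g); rewrite -mulgA mulVKg.
(* Passing from [r (a * g)] to [a * r g], then to [a * g], multiplies by two elements of [s], which
   [kaM] merges. *)
have phi_act x a g : phi (act x a) g = phi x (a * g)%g.
  rewrite {1}/phi co_act // /phi rMr -kaM //; last by rewrite -rMr.
  by congr ka; rewrite !mulgA mulgK.
exists act; split.
- by move=> x; apply/funext => n; rewrite /act mul1g /phi dlS mulVg ka1 /co gmdl.
- by move=> x a b; apply/funext => n; rewrite /act phi_act mulgA.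
- move=> a; apply: agree_coordinatewise => n.
  rewrite /act; set g := (a * _)%g; set i := (dl n).2.
  have [m mP] := kac _ i.+1 (rs g).
  (* Only the positions in [x] of the first [m] coordinates of [co x (r g)] matter. *)
  exists (\max_(j < m) (gm (r g) j).+1)%N => x y xy.
  apply: mP (ltnSn i) => j jm; apply: xy.
  exact: (@leq_bigmax _ (fun j : 'I_m => (gm (r g) j).+1) (Ordinal jm)).
(* The witness is the component at the trivial coset, whose first [M] coordinates are those of [x]
   by [gm1]. *)
- move=> x k ks; exists (co x 1%g); split.
    by move=> i iM; rewrite /co gm1.
  have r_k : r k = 1%g by rewrite -r1 -[in RHS](rM 1%g k) // mul1g.
  have phik : phi x k = ka k (co x 1%g) by rewrite /phi r_k invg1 mul1g.
  move=> i iM; rewrite -phik -[k in RHS]mulg1 -phi_act.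
  by rewrite /phi r1 invg1 mulg1 ka1 /co gm1.
Qed.

End Coinduction.

(** * Density of covering actions *)

Lemma word_points_hit (T : eqType) (t0 : T) (s : seq T) (M : nat) :
  uniq s -> (2 ^ M <= size s)%N ->
  exists z : T -> X, forall u : X, exists2 t, t \in s & agree M (z t) u.
Proof.
move=> us sM; pose W := enum {: M.-tuple bool}.
have W0 := tcast (size_nseq M false) (in_tuple (nseq M false)).
exists (fun t => word_point (nth W0 W (index t s))) => u.
pose w := [tuple u i | i < M].
have wW : w \in W by rewrite mem_enum.
have ws : (index w W < size s)%N.
  apply: leq_trans sM; have := card_tuple M bool; rewrite card_bool => <-.
  by rewrite cardE index_mem.
exists (nth t0 s (index w W)); first exact: mem_nth.
rewrite index_uniq // nth_index // => i iM.
by rewrite /word_point -[i]/(nat_of_ord (Ordinal iM)) -tnth_nth tnth_mktuple.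
Qed.

(** * Isometric actions by signed composition *)

Section SignedAction.
Variables (R : realType) (G : groupType) (act : X -> G -> X) (c : X -> R).
Hypothesis act1 : forall x, act x 1%g = x.
Hypothesis actM : forall x a b, act (act x a) b = act x (a * b)%g.
Hypothesis act_cont : forall a n, exists m, forall x y : X,
  agree m x y -> agree n (act x a) (act y a).
Hypothesis cc : forall x, c x * c x = 1.
Hypothesis c_cont : exists m, forall x y : X, agree m x y -> c x = c y.

Let c_norm x : `|c x| = 1.
Proof.
apply/eqP; rewrite -(@eqrXn2 _ 2%N) // expr1n real_normK ?num_real //.
by rewrite expr2 cc.
Qed.

(** The sign is a coboundary, so its cocycle identity is automatic and [sig] inherits
    multiplicativity from [act]. *)
Let sig (a : G) (f : CK R) : X -> R := fun x => c x * c (act x a) * sval f (act x a).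

Let sig_ucont a f : ucont (sig a f).
Proof.
move=> e e0; have [m mP] := c_cont; have [k kP] := CK_ucont f e0.
have [l lP] := act_cont a (maxn m k); exists (maxn m l) => x y xy.
have /lP {}lP : agree l x y by apply: agree_leq xy; exact: leq_maxr.
rewrite /sig (mP x y); last by apply: agree_leq xy; exact: leq_maxl.
rewrite (mP (act x a) (act y a)); last by apply: agree_leq lP; exact: leq_maxl.
rewrite -mulrBr !normrM !c_norm !mul1r; apply: kP.
by apply: agree_leq lP; exact: leq_maxr.
Qed.

Lemma signed_action : exists sigma : G -> CK R -> CK R, is_action sigma /\
  forall a f x, sval (sigma a f) x = c x * c (act x a) * sval f (act x a).
Proof.
pose sigma a f := mkCK (@sig_ucont a f); exists sigma; split => //.
have sM a b f : sigma (a * b)%g f = sigma a (sigma b f).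
  apply: CK_ext => x /=; rewrite /sig /= /sig actM.
  by rewrite -!mulrA; congr (_ * _); rewrite mulrA cc mul1r.
have s1 f : sigma 1%g f = f.
  by apply: CK_ext => x; rewrite /= /sig act1 cc mul1r.
split=> // a; split.
- by move=> t f g h hE x; rewrite /= /sig hE; ring.
- move=> f; have sE x : `|sval (sigma a f) x| = `|sval f (act x a)|.
    by rewrite /= /sig !normrM !c_norm !mul1r.
  apply/le_anti/andP; split; apply: supnorm_le => x.
    by rewrite sE supnorm_ub.
  have := supnorm_ub (sigma a f) (act x a^-1%g).
  by rewrite sE actM mulVg act1.
- by move=> g; exists (sigma a^-1%g g); rewrite -sM mulgV.
Qed.

End SignedAction.

Section Density.
Variables (R : realType) (G : groupType).
Hypotheses (Gcount : countable [set: G]) (Glf : locally_finite G).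
Hypothesis Ginf : infinite_set [set: G].

Lemma large_subgroup (H : seq G) (k : nat) : exists K, [/\ fin_subgroup K,
  {subset H <= K} & (k <= size K)%N].
Proof.
have [B _ Bk] := infinite_set_fset k Ginf.
have [K [Ks lK]] := fin_subgroup_exists Glf (H ++ finmap.enum_fset B).
exists K; split => // [x xH|]; first by apply: lK; rewrite mem_cat xH.
apply: (leq_trans Bk); apply: uniq_leq_size; first exact: finmap.fset_uniq.
by move=> x xB; apply: lK; rewrite mem_cat xB orbT.
Qed.

(** Every [g] in [K] is [r g] times an element of [H], so [size K] is at most the number of
    representatives times [size H]. *)
Lemma transversal_size (H K : seq G) (r : G -> G) k : fin_subgroup H -> uniq K ->
  (forall g, ((r g)^-1 * g)%g \in H) -> (k * size H <= size K)%N ->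
  (k <= size (undup (map r K)))%N.
Proof.
move=> [_ H1 _ _] uK rH kK.
have H0 : (0 < size H)%N by case: (H) H1.
rewrite -(leq_pmul2r H0); apply: (leq_trans kK).
rewrite -(size_allpairs (fun t h => t * h)%g); apply: uniq_leq_size => // g gK.
apply/allpairsP; exists (r g, (r g)^-1 * g)%g; split => //=.
  by rewrite mem_undup map_f.
by rewrite mulVKg.
Qed.

Variables (rho : G -> CK R -> CK R).
Hypothesis rhoA : is_action rho.

(* Transporting [rho] along the cosets of [H]: the signed points [b j, p j] form an
   [H]-equivariant image of [K] that meets every cylinder of length [M]. *)
Lemma equivariant_points (H : seq G) (M : nat) : fin_subgroup H ->
  exists (K : seq G) (b : G -> R) (p : G -> X),
  [/\ fin_subgroup K, {subset H <= K}, forall j, b j * b j = 1,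
      forall j h (f : CK R), h \in H ->
        sval (rho h f) (p j) = b j * b (j * h)%g * sval f (p (j * h)%g) &
      forall u : X, exists2 j, j \in K & agree M (p j) u].
Proof.
move=> Hs; have [K [Ks HK Ksize]] := large_subgroup H (2 ^ M * size H).
have [r [_ rs rM]] := coset_rep Hs.
have [uK K1 KM KV] := Ks; have [uH H1 HM HV] := Hs.
have [z zP] := word_points_hit 1%g (undup_uniq (map r K))
  (transversal_size Hs uK rs Ksize).
(* The signed point of [j] is where the element [(r j)^-1 * j] of [H] sends evaluation at [z (r j)];
   equivariance follows as [r] is constant on cosets. *)
have /choice[bp bpP] : forall j, exists sy : R * X, sy.1 * sy.1 = 1 /\ forall f,
    sval (rho ((r j)^-1 * j)%g f) (z (r j)) = sy.1 * sval f sy.2.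
  by move=> j; exact: action_point.
exists K, (fun j => (bp j).1), (fun j => (bp j).2); split => //.
- by move=> j; case: (bpP j).
- move=> j h f hH; have [bj pj] := bpP j; have [_ pjh] := bpP (j * h)%g.
  rewrite -mulrA -pjh rM // mulgA (actionM rhoA) pj.
  by rewrite mulrA bj mul1r.
- move=> u; have [t] := zP u; rewrite mem_undup => /mapP[k kK tk] tu.
  have rk : (k^-1 * r k)%g \in H by have := HV _ (rs k); rewrite invgM invgK.
  have rt : r t = t by rewrite tk -[RHS](rM _ _ rk) mulVKg.
  exists t; first by rewrite tk -(mulVKg k (r k)) KM // HK.
  (* At a representative the group element is [1], and testing on the cylinder around [u] locates
     [p t] in it. *)
  have [_ /(_ (cyl R M u))] := bpP t.
  rewrite rt mulVg (action1 rhoA) cyl_in; last exact: agree_sym.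
  move=> bp1; apply: agree_sym; apply: (@cyl_gt0 R); rewrite normr_gt0.
  by apply/eqP => c0; move: bp1; rewrite c0 mulr0 => /eqP; rewrite oner_eq0.
Qed.

(** Piece [j] lies in the [M]-cylinder of [p j], each [h] in [K] sends it to piece [j * h], and [b]
    supplies signs. On [H] the new action then differs from [rho] only by oscillations over
    [M]-cylinders, while transitivity of [K] on the pieces gives the covering. *)
Lemma covering_dense n (gf : nat -> G * CK R) (e : R) N (x0 : X) : 0 < e ->
  exists sigma, [/\ is_action sigma, act_ball rho n gf e sigma &
    exists l : seq G, forall y, exists2 a, a \in l &
      `|sval (sigma a (cyl R N x0)) y| = 1].
Proof.
move=> e0; have e3 : 0 < e / 3 by rewrite divr_gt0.
have [H [Hs gfH]] := fin_subgroup_exists Glf [seq (gf i).1 | i <- iota 0 n].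
have [M0 M0P] : exists m, forall hi, hi \in [seq (h, i) | h <- H, i <- iota 0 n] ->
    forall x y : X, agree m x y ->
    `|sval (rho hi.1 (gf hi.2).2) x - sval (rho hi.1 (gf hi.2).2) y| < e / 3.
  apply: uniform_bound => [hi m m' mm' mP x y xy|hi].
    by apply: mP; exact: agree_leq xy.
  exact: CK_ucont e3.
pose M := maxn N M0.
have [K [b [p [Ks HK bb bp surj]]]] := equivariant_points M Hs.
have b1 j : `|b j| = 1.
  apply/eqP; rewrite -(@eqrXn2 _ 2%N) // expr1n real_normK ?num_real //.
  by rewrite expr2 bb.
have [uK K1 KM KV] := Ks; have [_ H1 _ _] := Hs.
have [kappa [enc [rest [kP decP encP kagree ragree]]]] := prefix_code uK surj.
pose ka (h : G) (x : X) := enc (kappa x * h)%g (rest x).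
have kaK h x : h \in K -> kappa (ka h x) = (kappa x * h)%g /\ rest (ka h x) = rest x.
  by move=> hK; apply: decP; apply: KM => //; case: (kP x).
(* Depth [M + size K] determines [kappa], so the coinduced action permutes the pieces exactly as
   [ka] does. *)
have [act [act1 actM actc actka]] : exists act : X -> G -> X,
  [/\ forall x, act x 1%g = x, forall x a b, act (act x a) b = act x (a * b)%g,
      forall a n, exists m, forall x y : X, agree m x y -> agree n (act x a) (act y a) &
      forall x k, k \in K -> exists x' : X,
        agree (M + size K) x x' /\ agree (M + size K) (act x k) (ka k x')].
  apply: coinduced_action => // [k l x kK lK|x|k m kK].
  - by have [kx rx] := kaK k x kK; rewrite {2}/ka kx rx /ka mulgA.
  - by rewrite /ka mulg1 encP.
  - exists (m + (M + size K))%N => x y xy; rewrite /ka (kagree x y).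
      exact: (ragree m _ _).2 ((ragree m x y).1 xy) _.
    by apply: agree_leq xy; exact: leq_addl.
have kact x h : h \in K -> kappa (act x h) = (kappa x * h)%g.
  move=> hK; have [x' [xx' hx']] := actka x h hK.
  by rewrite (kagree _ _ hx') (kagree _ _ xx'); case: (kaK h x' hK).
have [sigma [sA sE]] : exists sigma : G -> CK R -> CK R, is_action sigma /\
    forall a f x, sval (sigma a f) x =
      b (kappa x) * b (kappa (act x a)) * sval f (act x a).
  apply: (@signed_action R G act (b \o kappa)) => // [x|]; first exact: bb.
  by exists (M + size K)%N => x y /kagree /= ->.
exists sigma; split => //.
- move=> i ni; set a := (gf i).1; set f := (gf i).2.
  have aH : a \in H by apply: gfH; rewrite map_f // mem_iota.
  have osc h : h \in H -> forall x y : X, agree M x y ->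
      `|sval (rho h f) x - sval (rho h f) y| < e / 3.
    move=> hH x y xy; apply: (M0P (h, i)).
      by apply/allpairsP; exists (h, i); rewrite mem_iota.
    by apply: agree_leq xy; exact: leq_maxr.
  (* Pointwise bounds give only a weak inequality for the supremum; using thirds of [e] leaves room
     for the strict one. *)
  suff : supnorm (fun x : X => sval (sigma a f) x - sval (rho a f) x) <= e / 3 + e / 3.
    by move=> /le_lt_trans; apply; lra.
  apply: supnorm_le => x; set j := kappa x.
  have [_ jx] := kP x; have [_] := kP (act x a).
  rewrite (kact _ _ (HK _ aH)) -/j => jax.
  rewrite sE (kact _ _ (HK _ aH)) -/j.
  have := osc _ aH _ _ jx; rewrite (bp j a f aH).
  have := osc _ H1 _ _ jax; rewrite (action1 rhoA).
  set s := b j * _; have s1 : `|s| = 1 by rewrite normrM !b1 mulr1.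
  set u := sval f _; set v := sval f _; set w := sval _ x => uv uw.
  have -> : s * v - w = s * (v - u) + (s * u - w) by ring.
  apply: le_trans (ler_normD _ _) _; rewrite normrM s1 mul1r.
  by apply: ltW; rewrite ltrD // distrC.
(* [(kappa y)^-1 * j0] moves [y] into piece [j0], which lies in the given cylinder because
   [N <= M]. *)
- exists K => y; have [j0 j0K j0x] := surj x0.
  have [yK _] := kP y; have aK : ((kappa y)^-1 * j0)%g \in K by rewrite KM ?KV.
  exists ((kappa y)^-1 * j0)%g => //; rewrite sE !normrM !b1 !mul1r.
  rewrite cyl_in ?normr1 //; have [_] := kP (act y ((kappa y)^-1 * j0)%g).
  rewrite kact // mulVKg => j0y.
  apply: (@agree_leq _ M); first exact: leq_maxl.
  exact: agree_trans (agree_sym j0x) j0y.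
Qed.

End Density.

(** Density yields a nearby [sigma] whose cover has values of modulus exactly [1]. Any action within
    [1/2] of it on [cyl R n x], for the finitely many [a] in [l], still covers, so [sigma] is
    outside the closure. *)
Lemma not_covering_nowhere_dense (R : realType) (G : groupType)
    (Gcount : countable [set: G]) (Glf : locally_finite G) n (x : X) :
  infinite_set [set: G] ->
  act_nowhere_dense [set rho : G -> CK R -> CK R | ~ covering rho n x].
Proof.
move=> Ginf V [VA Vo] VN; apply/seteqP; split => // rho Vrho.
have [m [gf [e [e0 ballV]]]] := Vo rho Vrho.
have [sigma [sA sball [l lP]]] :=
  covering_dense Gcount Glf Ginf (VA _ Vrho) m gf n x e0.
have [_ scl] := VN sigma (ballV _ (conj sA sball)).
have half0 : 0 < 2^-1 :> R by rewrite invr_gt0.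
have [tau [tA ntau tball]] :=
  scl (size l) (fun i => (nth 1%g l i, cyl R n x)) _ half0.
apply: ntau; exists l => y; have [a al sa] := lP y; exists a => //.
have := tball (index a l); rewrite index_mem al /= nth_index // => /(_ isT).
set t := tau a _; set s := sigma a _.
have -> : (fun x => sval t x - sval s x) = sval (lincomb (- 1) s t).
  by apply/funext => z; rewrite /= mulN1r addrC.
move=> /(le_lt_trans (supnorm_ub _ y)) /=; rewrite mulN1r addrC.
have := ler_normB (sval s y - sval t y) (- sval t y).
rewrite opprK subrK normrN (distrC (sval s y)) sa; lra.
Qed.

Theorem theorem6p4 (R : realType) (G : groupType)
  (Gcount : countable [set: G]) (Glf : locally_finite G) :
  act_comeager [set rho : G -> CK R -> CK R |
                  @Act G R rho /\ admits_inv_strictly_convex_norm rho].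
Proof.
have [H [Hs Hexh]] := exhausting_subgroups Gcount Glf.
have [Gfin|Ginf] := pselect (finite_set [set: G]).
  have /finite_seqP[s sE] := Gfin.
  (* Every action admits the norm here, so empty sets suffice. *)
  exists (fun=> set0); split => [_ V _ VN|rho [rhoA nadm]].
    apply/seteqP; split => // rho /VN [_].
    by move=> /(_ 0%N (fun=> (1%g, cstCK 0)) 1 ltr01) [? []].
  exfalso; apply: nadm; split => //; apply: (admits_of_finite rhoA Hs Hexh (s := s)).
  by move=> a; have : [set: G] a by []; rewrite sE.
(* Cylinders are coded by a length and a word, which leaves countably many conditions. *)
pose Ns k : set (G -> CK R -> CK R) :=
  let nw := odflt (0%N, [::]) (unpickle k) : nat * seq bool in
  [set rho | ~ covering rho nw.1 (word_point nw.2)].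
exists Ns; split => [k|rho [rhoA nadm]]; first exact: not_covering_nowhere_dense.
apply: contrapT => nNs; apply: nadm; split => //.
apply: (admits_of_covering rhoA Hs Hexh) => n x; apply: contrapT => ncov.
apply: nNs; exists (pickle (n, mkseq x n)) => //; rewrite /Ns pickleK /= => cov.
apply: ncov; rewrite /covering.
(* A cylinder sees only the first [n] bits of its centre. *)
suff <- : cyl R n (word_point (mkseq x n)) = cyl R n x by [].
have xw : agree n x (word_point (mkseq x n)).
  by move=> i ni; rewrite /word_point nth_mkseq.
apply: CK_ext => y /=; congr (_%:R); congr nat_of_bool; apply: asbool_equiv_eq.
by split; apply: agree_trans => //; exact: agree_sym.
Qed.
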